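(* Let $n\ge 3$ and let $G=D_{2n}$ be the dihedral group of order $2n$. Suppose $S$ is a locally maximal product-free set of size $4$ in $G$. Then $|G|\in\{8,10,12,14,16,18,20\}$ and, up to automorphisms of $G$, the possible choices of $S$ are exactly the following: - $|G|=8$: $\{y,xy,x^2y,x^3y\}$, $\{x,x^3,y,x^2y\}$; - $|G|=10$: $\{x^2,x^3,y,x^4y\}$; - $|G|=12$: $\{x^3,y,xy,x^2y\}$, $\{x^2,x^3,y,x^5y\}$, $\{x,x^5,y,x^3y\}$, $\{x,x^4,y,x^3y\}$; - $|G|=14$: $\{x^2,x^3,y,x^6y\}$; - $|G|=16$: $\{x^2,x^3,y,x^7y\}$, $\{x,x^6,y,x^4y\}$; - $|G|=18$: $\{x^2,x^5,y,x^8y\}$; - $|G|=20$: $\{x,x^8,y,x^5y\}$. (That is, each listed set is a locally maximal product-free set in the corresponding group, and every locally maximal product-free set of size $4$ in a dihedral group $G$ is the image, under an automorphism of $G$, of one of the sets listed for $|G|$.)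
   Context: For $n>1$, $D_{2n}=\langle x,y \mid x^n=y^2=1,\ xy=yx^{-1}\rangle$ is the dihedral group of order $2n$. For subsets $S,V$ of a group $G$, $SV=\{sv : s\in S, v\in V\}$. A non-empty subset $S$ of a finite group $G$ is product-free if $S\cap SS=\varnothing$. A product-free set $S$ is locally maximal if whenever $T$ is a product-free subset of $G$ with $S\subseteq T$, then $S=T$. *)

(* Defs.v *)
From mathcomp Require Export all_boot all_fingroup all_solvable.

Set Implicit Arguments.
Unset Strict Implicit.
Unset Printing Implicit Defensive.

Import GroupScope.

(* The presentation D_2n = < x, y | x^n = y^2 = 1, xy = yx^-1 > with its
   generators named; the library's 'D_m has index m = its order, here n.*2. *)
Definition dihedral_generators (gT : finGroupType) (G : {group gT}) (n : nat)
    (x y : gT) : Prop :=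
  G \isog 'D_(n.*2) /\
  [/\ G = <<[set x; y]>> :> {set gT}, x ^+ n = 1, y ^+ 2 = 1
    & x * y = y * x^-1].

Lemma dihedral_generators_exist (n : nat) : (1 < n)%N ->
  exists x y : 'D_(n.*2), dihedral_generators [set: 'D_(n.*2)]%G n x y.
Proof.
move=> n_gt1; have /existsP[[x y] /=] :
    'D_(n.*2) \homg Grp (x : y : x ^+ n, y ^+ 2, x ^ y = x^-1).
  by rewrite -(Grp_dihedral n_gt1) homg_refl.
rewrite !xpair_eqE => /and4P[/eqP defG /eqP xn /eqP y2 /eqP xy].
exists x, y; split; first exact: isog_refl.
split=> //; last by rewrite conjgC xy.
by rewrite /= -[LHS]defG joing_idl joing_idr.
Qed.

Section ProductFree.

Variables (gT : finGroupType) (G : {group gT}).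

Definition product_free (S : {set gT}) : bool :=
  [&& S \subset G, S != set0 & S :&: (S * S) == set0].

Definition locally_maximal_product_free (S : {set gT}) : Prop :=
  product_free S /\
  forall T : {set gT}, product_free T -> S \subset T -> S = T.

End ProductFree.

(* The sets listed for a dihedral group of order m generated by x and y. *)
Definition listed_sets (gT : finGroupType) (x y : gT) (m : nat) :
    seq {set gT} :=
  match m with
  | 8 => [:: [set y; x * y; x ^+ 2 * y; x ^+ 3 * y];
             [set x; x ^+ 3; y; x ^+ 2 * y]]
  | 10 => [:: [set x ^+ 2; x ^+ 3; y; x ^+ 4 * y]]
  | 12 => [:: [set x ^+ 3; y; x * y; x ^+ 2 * y];
              [set x ^+ 2; x ^+ 3; y; x ^+ 5 * y];
              [set x; x ^+ 5; y; x ^+ 3 * y];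
              [set x; x ^+ 4; y; x ^+ 3 * y]]
  | 14 => [:: [set x ^+ 2; x ^+ 3; y; x ^+ 6 * y]]
  | 16 => [:: [set x ^+ 2; x ^+ 3; y; x ^+ 7 * y];
              [set x; x ^+ 6; y; x ^+ 4 * y]]
  | 18 => [:: [set x ^+ 2; x ^+ 5; y; x ^+ 8 * y]]
  | 20 => [:: [set x; x ^+ 8; y; x ^+ 5 * y]]
  | _ => [::]
  end.

(* Main.v *)
Require Import Defs.
Set Implicit Arguments.
Unset Strict Implicit.
Unset Printing Implicit Defensive.
Import GroupScope.

(* Let S have a rotations and b reflections, a + b = 4. If g is a reflection
   outside S, then g |: S is not product-free, and since the product of two
   reflections is a rotation this forces g to be r^-1 t or r t with r a rotation
   and t a reflection of S. Counting reflections gives n <= b (1 + 2 a), hence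
   n <= 10, and the groups that remain are settled by enumerating the subsets of
   size 4 and the automorphisms x |-> x^u, y |-> x^v y. *)

(** * Product-free sets and the bound on the number of reflections *)

Section ProductFreeFacts.

Variables (gT : finGroupType) (G : {group gT}).
Implicit Types S T : {set gT}.

Lemma product_freeP S :
  reflect [/\ S \subset G, S != set0 & {in S &, forall a b, a * b \notin S}]
          (product_free G S).
Proof.
apply: (iffP and3P) => [] [sSG S_n0 SS].
  split=> // a b Sa Sb; apply: contraL SS => Sab.
  by apply/set0Pn; exists (a * b); rewrite inE Sab mem_mulg.
split=> //; apply/eqP/setP=> z; rewrite !inE; apply/andP=> -[Sz].
by case/mulsgP=> a b Sa Sb def_z; move: (SS a b Sa Sb); rewrite -def_z Sz.
Qed.

Lemma sub_product_free S T :
  S \subset T -> S != set0 -> product_free G T -> product_free G S.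
Proof.
move=> sST S_n0 /product_freeP[sTG _ TT]; apply/product_freeP.
split=> // [|a b Sa Sb]; first exact: subset_trans sTG.
by apply: contra (TT a b (subsetP sST a Sa) (subsetP sST b Sb)); apply/subsetP.
Qed.

(** Product-freeness passes to non-empty subsets, so a product-free set properly containing [S]
    yields a product-free [g |: S]. Local maximality can thus be tested one element at a time. *)
Lemma locally_maximalP S :
  locally_maximal_product_free G S <->
  product_free G S /\ {in G :\: S, forall g, ~~ product_free G (g |: S)}.
Proof.
split=> -[pfS maxS]; split=> //.
  move=> g /setDP[Gg]; apply: contra => pfgS.
  by rewrite (maxS _ pfgS (subsetUr _ _)) setU11.
move=> T pfT sST; apply/eqP; rewrite eqEsubset sST; apply/subsetP=> g Tg.
have [/subsetP sTG _ _] := product_freeP _ pfT.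
apply/negPn/negP=> S'g.
have /maxS/negP[] : g \in G :\: S by rewrite inE S'g sTG.
apply: sub_product_free pfT; first by rewrite subUset sub1set Tg.
by apply/set0Pn; exists g; apply: setU11.
Qed.

(* Maximality forces an element of G :\: R outside S to be of the form a * t or
   a^-1 * t with a in S :&: R and t in S :\: R. *)
Lemma locally_maximal_card_bound (R : {group gT}) S :
    {in G :\: R &, forall s t, s * t \in R} ->
    {in G :\: R, forall t, t * t = 1} ->
    locally_maximal_product_free G S ->
  #|G :\: R| <= #|S :\: R| * (#|S :&: R|.*2).+1.
Proof.
move=> odd_mul invol /locally_maximalP[/product_freeP[sSG S_n0 SS] maxS].
set A := S :&: R; set B := S :\: R.
have S1 : 1 \notin S.
  by apply/negP=> S1; move: (SS _ _ S1 S1); rewrite mulg1 S1.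
have sG := subsetP sSG.
(* The three pieces have at most |B|, |A||B| and |A||B| elements. *)
suff sGR : G :\: R \subset B :|: (A * B :|: A^-1 * B).
  apply: leq_trans (subset_leq_card sGR) _.
  rewrite mulnS (leq_trans (leq_card_setU _ _)) // leq_add2l.
  rewrite (leq_trans (leq_card_setU _ _)) // -addnn mulnDr.
  have cM (C : {set gT}) : #|C * B| <= #|B| * #|C|.
    have -> : C * B = [set u.1 * u.2 | u in setX C B].
      apply/setP=> z; apply/mulsgP/imsetP=> [[a b Ca Bb ->] | [[a b] /=]].
        by exists (a, b); rewrite // inE Ca.
      by rewrite inE => /andP[Ca Bb] ->; exists a b.
    by rewrite (leq_trans (leq_imset_card _ _)) // cardsX mulnC.
  by rewrite leq_add // -?(card_invg A) cM.
(* Both [t] and [t * r] are involutions, hence [t] inverts [r]. *)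
have invVR r t : r \in A -> t \in G :\: R -> t * r = r^-1 * t.
  case/setIP=> Sr Rr Gt; have Gtr : t * r \in G :\: R.
    have [Gt1 R't] := setDP Gt.
    by rewrite inE groupMr // R't groupM // sG.
  apply: (mulgI (t * r)); rewrite invol // -!mulgA mulKVg.
  by rewrite invol.
have inA z : z \in S -> z \in R -> z \in A by move=> ? ?; apply/setIP.
have inB z : z \in S -> z \notin R -> z \in B by move=> ? ?; apply/setDP.
have inAB z t : z \in A -> t \in B -> z * t \in B :|: (A * B :|: A^-1 * B).
  by move=> Az Bt; rewrite 2!in_setU (mem_mulg Az Bt) orbT.
have inVB z t : z \in A -> t \in B -> z^-1 * t \in B :|: (A * B :|: A^-1 * B).
  rewrite -[z in z \in A]invgK -mem_invg => A'z Bt.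
  by rewrite 2!in_setU (mem_mulg A'z Bt) !orbT.
have BG t : t \in B -> t \in G :\: R.
  by case/setDP=> St R't; rewrite inE R't sG.
apply/subsetP=> g GRg; have [Gg R'g] := setDP GRg.
have [Sg | S'g] := boolP (g \in S); first by rewrite inE inB.
have := maxS g; rewrite inE S'g => /(_ Gg) /product_freeP not_pf.
have [a [b [gSa gSb gSab]]] :
    exists a b, [/\ a \in g |: S, b \in g |: S & a * b \in g |: S].
  have [[a b] | none] := pickP [pred u : gT * gT |
      [&& u.1 \in g |: S, u.2 \in g |: S & u.1 * u.2 \in g |: S]].
    by case/and3P; exists a, b.
  case: not_pf; split; first by rewrite subUset sub1set Gg.
    by apply/set0Pn; exists g; apply: setU11.
  by move=> a b gSa gSb; have /= := none (a, b); rewrite gSa gSb => /negbT.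
(* Eight cases, according to which of [a], [b], [a * b] equal [g]. Two or three equalities force 1
   into [S] or [g] into [R], and so does [g * g] in [S]; no equality contradicts [SS]. The other
   three are solved for [g], where parity leaves one rotation and one reflection of [S]. *)
case/setU1P: gSa gSab => [-> | Sa]; case/setU1P: gSb => [-> | Sb];
    case/setU1P=> [def_g | Sab].
- by case/negP: R'g; rewrite -def_g invol.
- by case/negP: S1; rewrite -(invol g).
- by case/negP: S1; rewrite -(mulKg g b) def_g mulVg in Sb.
- have [Rb | R'b] := boolP (b \in R).
    have Ab := inA b Sb Rb; rewrite -(mulKVg b g) -invVR //.
    by apply: inAB; rewrite // inB // groupMr.
  have Bb := inB b Sb R'b; have GRb := BG b Bb.
  rewrite -[g]mulg1 -(invol b) // mulgA.
  by apply: inAB => //; apply: inA; rewrite ?odd_mul.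
- by case/negP: S1; rewrite -(mulgK g a) def_g mulgV in Sa.
- rewrite -(mulKg a g); have [Ra | R'a] := boolP (a \in R).
    by apply: inVB; [apply: inA | apply: inB; rewrite ?groupMl].
  have Ba := inB a Sa R'a; have GRa := BG a Ba.
  have -> : a^-1 = a by apply: (mulgI a); rewrite mulgV invol.
  have Aab : a * g \in A by apply: inA; rewrite ?odd_mul.
  by rewrite invVR // inVB.
- rewrite -def_g; have [Ra | R'a] := boolP (a \in R).
    apply: inAB; first exact: inA.
    by apply: inB; rewrite // -(groupMl _ Ra) def_g.
  have Ba := inB a Sa R'a; have GRa := BG a Ba.
  have [Rb | R'b] := boolP (b \in R).
    by have Ab := inA b Sb Rb; rewrite invVR // inVB.
  have GRb := BG b (inB b Sb R'b).
  by case/negP: R'g; rewrite -def_g odd_mul.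
by have := SS a b Sa Sb; rewrite Sab.
Qed.

End ProductFreeFacts.

(** * Computation with codes: product-free sets, automorphisms, enumeration *)

(* The pair [(i, b)] encodes the element x^i y^b; exponents are natural numbers
   below [n], and [mulc] follows from y x^i = x^(n - i) y. *)
Definition code := (nat * bool)%type.

Definition codes (n : nat) : seq code :=
  [seq (i, b) | b <- [:: false; true], i <- iota 0 n].

Definition mulc (n : nat) (k l : code) : code :=
  ((k.1 + (if k.2 then n - l.1 else l.1)) %% n, k.2 (+) l.2).

(** Non-emptiness is not tested; it enters as [s != [::]] when codes are transferred to sets. *)
Definition product_free_code (n : nat) (s : seq code) : bool :=
  all (fun k => all (fun l => mulc n k l \notin s) s) s.

Definition maximal_code (n : nat) (s : seq code) : bool :=
  all (fun k => (k \in s) || ~~ product_free_code n (k :: s)) (codes n).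

(** For [uv] = (u, v) this is x |-> x^u, y |-> x^v y, as x^i y is sent to x^(u i + v) y. *)
Definition aut_code (n : nat) (uv : nat * nat) (k : code) : code :=
  ((uv.1 * k.1 + (if k.2 then uv.2 else 0)) %% n, k.2).

(** Multiplicativity and injectivity are tested on all codes, instead of being derived from the
    coprimality of u and n; [valid_aut_Aut] consumes them in this form. *)
Definition aut_code_valid (n : nat) (uv : nat * nat) : bool :=
  all (fun k => all (fun l => aut_code n uv (mulc n k l) ==
    mulc n (aut_code n uv k) (aut_code n uv l)) (codes n)) (codes n)
  && uniq (map (aut_code n uv) (codes n)).

Definition valid_auts (n : nat) : seq (nat * nat) :=
  [seq uv <- [seq (u, v) | u <- iota 0 n, v <- iota 0 n] | aut_code_valid n uv].

Local Notation rot i := (i%N, false).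
Local Notation refl i := (i%N, true).

(** Indexed by n, half of the order that indexes [listed_sets]. *)
Definition listed_codes (n : nat) : seq (seq code) :=
  match n with
  | 4 => [:: [:: refl 0; refl 1; refl 2; refl 3];
             [:: rot 1; rot 3; refl 0; refl 2]]
  | 5 => [:: [:: rot 2; rot 3; refl 0; refl 4]]
  | 6 => [:: [:: rot 3; refl 0; refl 1; refl 2];
             [:: rot 2; rot 3; refl 0; refl 5];
             [:: rot 1; rot 5; refl 0; refl 3];
             [:: rot 1; rot 4; refl 0; refl 3]]
  | 7 => [:: [:: rot 2; rot 3; refl 0; refl 6]]
  | 8 => [:: [:: rot 2; rot 3; refl 0; refl 7];
             [:: rot 1; rot 6; refl 0; refl 4]]
  | 9 => [:: [:: rot 2; rot 5; refl 0; refl 8]]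
  | 10 => [:: [:: rot 1; rot 8; refl 0; refl 5]]
  | _ => [::]
  end.

(** Keeping the order of [s] makes each subset of codes appear once: at n = 10 there are only 4845
    candidates of size 4. *)
Fixpoint subseqs (T : Type) (m : nat) (s : seq T) : seq (seq T) :=
  match m, s with
  | 0, _ => [:: [::]]
  | m'.+1, [::] => [::]
  | m'.+1, z :: s' => map (cons z) (subseqs m' s') ++ subseqs m s'
  end.

(* The two filters are nested so that [maximal_code] is only evaluated on
   product-free sequences, also under call by value. *)
Definition maximal_codes (n : nat) : seq (seq code) :=
  [seq s <- [seq s <- subseqs 4 (codes n) | product_free_code n s]
     | maximal_code n s].

(** The parameter [auts] lets the automorphisms be computed once per n; [perm_eq] is used because
    they need not preserve the order of the codes. *)
Definition equivalent_to_listed (n : nat) (auts : seq (nat * nat)) s : bool :=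
  has (fun c => has (fun uv => perm_eq (map (aut_code n uv) c) s) auts)
      (listed_codes n).

Lemma maximal_codes_listed (n : nat) : 3 <= n <= 10 ->
  all (equivalent_to_listed n (valid_auts n)) (maximal_codes n).
Proof.
have: all (fun n => let auts := valid_auts n in
    all (equivalent_to_listed n auts) (maximal_codes n)) (iota 3 8).
  by vm_compute.
by move/allP=> all_n n_bounds; apply: all_n; rewrite mem_iota.
Qed.

Lemma listed_codes_maximal (n : nat) (s : seq code) : s \in listed_codes n ->
  [/\ {subset s <= codes n}, uniq s, size s = 4, product_free_code n s
    & maximal_code n s].
Proof.
have: all (fun m => all (fun c => [&& all (mem (codes m)) c, uniq c,
    size c == 4, product_free_code m c & maximal_code m c]) (listed_codes m))
    (iota 0 11) by vm_compute.
have [n_le10 /allP all_n c_s | ] := leqP n 10; last first.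
  by do 11![case: n => // n].
have /all_n/allP/(_ s c_s) : n \in iota 0 11 by rewrite mem_iota.
by case/and5P=> /allP ? ? /eqP.
Qed.

Lemma mem_subseqs (T : eqType) (s t : seq T) :
  subseq s t -> s \in subseqs (size s) t.
Proof.
elim: t s => [|z t IHt] [|w s] //=; rewrite mem_cat.
case: eqP => [-> /IHt s_in | _ /IHt ->]; last by rewrite orbT.
by rewrite map_f.
Qed.

(** A converse of [map_inj_in_uniq]: equal images stand at equal positions. It gives the injectivity
    of both [elt] and [aut_code]. *)
Lemma uniq_map_inj_in (T1 T2 : eqType) (f : T1 -> T2) (s : seq T1) :
  uniq (map f s) -> {in s &, injective f}.
Proof.
move=> us a b sa sb eq_f; rewrite -(nth_index a sa) -(nth_index a sb).
congr nth; have/uniqP-/(_ (f a)) := us; apply.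
1,2: by rewrite inE size_map index_mem.
by rewrite !(nth_map a) ?index_mem ?nth_index.
Qed.

(** * Coordinates in a dihedral group and transfer from codes to subsets *)

Section DihedralCoordinates.

Variables (gT : finGroupType) (G : {group gT}) (n : nat) (x y : gT).
Hypotheses (n_ge3 : 3 <= n) (defG : dihedral_generators G n x y).

Definition elt (k : code) : gT := if k.2 then x ^+ k.1 * y else x ^+ k.1.

Let n_gt0 : 0 < n. Proof. exact: ltn_trans n_ge3. Qed.
Let xn1 : x ^+ n = 1. Proof. by case: defG => _ []. Qed.
Let yy : y * y = 1. Proof. by case: defG => _ [_ _ <- _]. Qed.

Lemma mem_codes (k : code) : (k \in codes n) = (k.1 < n).
Proof.
case: k => i b; apply/allpairsP/idP=> [[[c j] [_ /=]] | /= lt_i_n].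
  by rewrite mem_iota add0n => lt_j_n [-> _].
by exists (b, i); rewrite mem_iota; case: b.
Qed.

Lemma codes_uniq : uniq (codes n).
Proof.
by apply: allpairs_uniq; rewrite ?iota_uniq // => -[? ?] [? ?] _ _ [-> ->].
Qed.

Lemma size_codes : size (codes n) = n.*2.
Proof. by rewrite size_allpairs size_iota mul2n. Qed.

Lemma card_dihedral_generators : #|G| = n.*2.
Proof.
by case: defG => /card_isog-> _; rewrite card_dihedral // (ltn_trans _ n_ge3).
Qed.

Lemma mulc_codes (k l : code) : mulc n k l \in codes n.
Proof. by rewrite mem_codes ltn_pmod. Qed.

Lemma elt_mul (k l : code) : l \in codes n -> elt k * elt l = elt (mulc n k l).
Proof.
(* The natural number [n - i] stands for the exponent -i, whence the bound on [i]. *)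
have yx i : i <= n -> y * x ^+ i = x ^+ (n - i) * y.
  have [_ [_ _ _ xy]] := defG.
  move=> le_i_n; rewrite [RHS]conjgC conjXg conjgE xy mulKg expVgn.
  congr (_ * _).
  by apply/esym/eqP; rewrite eq_invg_mul -expgD subnK // xn1.
rewrite mem_codes; case: k l => [i []] [j []] /= /ltnW le_j_n;
  rewrite /elt /mulc /= expg_mod // expgD ?mulgA //.
  by rewrite -!mulgA (mulgA y) yx // -!mulgA yy mulg1.
by rewrite -mulgA yx // mulgA.
Qed.

(** The coded elements are closed under product and contain 1, [x] and [y], so they exhaust the
    group generated by [x] and [y]. *)
Lemma eltP (g : gT) : reflect (exists2 k, k \in codes n & g = elt k) (g \in G).
Proof.
have [_ [eqG _ _ _]] := defG; rewrite eqG.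
have group_elt : group_set [set g in map elt (codes n)].
  apply/group_setP; split=> [|a b].
    by rewrite inE; apply/mapP; exists (0, false); rewrite // mem_codes.
  rewrite !inE => /mapP[k _ ->] /mapP[l n_l ->].
  by rewrite elt_mul // map_f // mulc_codes.
apply: (iffP idP) => [Gg | [[i b] _ ->]].
  suff: g \in Group group_elt by rewrite inE => /mapP.
  move: g Gg; apply/subsetP; rewrite gen_subG subUset !sub1set !inE.
  apply/andP; split; apply/mapP.
    by exists (1%N, false); rewrite // mem_codes (ltn_trans _ n_ge3).
  by exists (0, true); rewrite ?mem_codes // /elt mul1g.
have Gx : x \in <<[set x; y]>> by rewrite mem_gen // !inE eqxx.
have Gy : y \in <<[set x; y]>> by rewrite mem_gen // !inE eqxx orbT.
by rewrite /elt; case: b => /=; rewrite ?groupM ?groupX.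
Qed.

Lemma elt_in_G (k : code) : k \in codes n -> elt k \in G.
Proof. by move=> n_k; apply/eltP; exists k. Qed.

(** The 2n codes cover a group of order 2n, so no element is hit twice. *)
Lemma elt_inj : {in codes n &, injective elt}.
Proof.
have uG : uniq (map elt (codes n)).
  apply: (@leq_size_uniq _ (enum G)); rewrite ?enum_uniq //.
    by move=> g; rewrite mem_enum => /eltP[k n_k ->]; apply: map_f.
  by rewrite size_map size_codes -cardE card_dihedral_generators.
exact: uniq_map_inj_in uG.
Qed.

Lemma rotation_elt (k : code) : k \in codes n -> (elt k \in <[x]>) = ~~ k.2.
Proof.
case: k => i [] n_k; rewrite /elt ?mem_cycle //=; apply/cycleP=> -[j].
rewrite -(expg_mod j xn1) => eq_xj.
have /(_ _ eq_xj) := @elt_inj (i, true) (j %% n, false) n_k.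
by rewrite mem_codes ltn_pmod // => /(_ isT).
Qed.

Lemma locally_maximal_index_bound (S : {set gT}) :
  locally_maximal_product_free G S -> #|S| = 4 -> n <= 10.
Proof.
move=> maxS S4; set R := <[x]>%G.
have xG : R \subset G.
  rewrite cycle_subG; apply: (@elt_in_G (1%N, false)).
  by rewrite mem_codes (ltn_trans _ n_ge3).
have reflP t : t \in G :\: R -> exists2 i, i < n & t = x ^+ i * y.
  case/setDP=> /eltP[[i b] n_k ->]; rewrite rotation_elt // negbK => /= b1.
  by exists i; [rewrite mem_codes in n_k | rewrite b1].
have mul_refl i j : j < n ->
    x ^+ i * y * (x ^+ j * y) = x ^+ ((i + (n - j)) %% n).
  by move=> lt_j_n; rewrite (@elt_mul (i, true) (j, true)) ?mem_codes.
(* The order of [x] divides n, so at least 2n - n elements lie outside [R]. *)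
have le_n : n <= #|G :\: R|.
  rewrite cardsD (setIidPr xG) card_dihedral_generators -addnn.
  by rewrite -addnBA ?leq_addr // dvdn_leq // order_dvdn xn1.
have := locally_maximal_card_bound _ _ maxS; rewrite /= -/R => /(_ R) bound.
apply: leq_trans le_n (leq_trans (bound _ _) _).
- move=> _ _ /reflP[i _ ->] /reflP[j lt_j_n ->].
  by rewrite mul_refl ?mem_cycle.
- by move=> _ /reflP[i lt_i_n ->]; rewrite mul_refl // subnKC ?modnn // ltnW.
(* With r rotations in [S] the bound is (4 - r)(2r + 1), that is 4, 9, 10, 7, 0 for r = 0, ...,
   4. *)
have := cardsID R S; rewrite S4; move: #|_| #|_| => a b.
by do 5?[case: a => [|a]] => //; case: b => // b; do 5?[case: b => // b].
Qed.

Definition set_of (s : seq code) : {set gT} := [set:: map elt s].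

Lemma mem_set_of (s : seq code) (k : code) :
  {subset s <= codes n} -> k \in codes n -> (elt k \in set_of s) = (k \in s).
Proof.
move=> sn n_k; rewrite inE; apply/mapP/idP=> [[l s_l eq_kl] | s_k].
  by rewrite (elt_inj n_k (sn l s_l) eq_kl).
by exists k.
Qed.

Lemma set_of_cons (k : code) (s : seq code) :
  set_of (k :: s) = elt k |: set_of s.
Proof. exact: set_cons. Qed.

Lemma card_set_of (s : seq code) :
  {subset s <= codes n} -> uniq s -> #|set_of s| = size s.
Proof.
move=> sn us; rewrite cardsE -(size_map elt); apply/card_uniqP.
by rewrite map_inj_in_uniq // => k l /sn n_k /sn n_l; apply: elt_inj.
Qed.

Lemma product_free_set_of (s : seq code) :
    {subset s <= codes n} -> s != [::] ->
  product_free G (set_of s) = product_free_code n s.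
Proof.
move=> sn s_n0; apply/product_freeP/allP=> [[_ _ SS] k s_k | SS].
  apply/allP=> l s_l; rewrite -mem_set_of ?mulc_codes // -elt_mul ?sn //.
  by apply: SS; rewrite mem_set_of ?sn.
split; first by apply/subsetP=> _ /[!inE]/mapP[k /sn n_k ->]; apply: elt_in_G.
  case: s s_n0 {sn SS} => // k s _; apply/set0Pn; exists (elt k).
  by rewrite set_of_cons setU11.
move=> _ _ /[!inE] /mapP[k s_k ->] /mapP[l s_l ->].
rewrite elt_mul ?sn // -[_ \in _]in_set mem_set_of ?mulc_codes //.
exact: (allP (SS k s_k)).
Qed.

Lemma locally_maximal_set_of (s : seq code) :
    {subset s <= codes n} -> s != [::] ->
  locally_maximal_product_free G (set_of s) <->
  product_free_code n s && maximal_code n s.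
Proof.
move=> sn s_n0; have n_cons k : k \in codes n -> {subset k :: s <= codes n}.
  by move=> n_k l; rewrite inE => /predU1P[-> // | /sn].
rewrite -product_free_set_of //; split=> [/locally_maximalP[-> maxS] | ].
  apply/allP=> k n_k; have [// | s'k] := boolP (k \in s).
  rewrite -product_free_set_of ?set_of_cons //; last exact: n_cons.
  by apply: maxS; rewrite inE mem_set_of ?s'k ?elt_in_G.
case/andP=> pfS /allP maxS; apply/locally_maximalP; split=> // g.
case/setDP=> /eltP[k n_k ->]; rewrite mem_set_of // => s'k.
have /orP[/(negP s'k) // | ] := maxS k n_k.
by rewrite -product_free_set_of ?set_of_cons //; apply: n_cons.
Qed.

(** A subsequence of [codes n] is provided so that [mem_subseqs] locates it in the enumeration. *)
Lemma set_of_surj (S : {set gT}) : S \subset G ->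
  exists2 s, subseq s (codes n) & S = set_of s.
Proof.
move=> /subsetP SG; exists [seq k <- codes n | elt k \in S].
  exact: filter_subseq.
apply/setP=> g; rewrite inE; apply/idP/mapP=> [Sg | [k]].
  have /eltP[k n_k def_g] := SG g Sg.
  by exists k; rewrite // mem_filter -def_g Sg.
by rewrite mem_filter => /andP[Sk _] ->.
Qed.

Lemma valid_aut_Aut (uv : nat * nat) : uv \in valid_auts n ->
  exists2 f, f \in Aut G
    & {in codes n, forall k, f (elt k) = elt (aut_code n uv k)}.
Proof.
rewrite mem_filter => /andP[/andP[/allP autM /uniq_map_inj_in aut_inj] _].
have aut_codes k : aut_code n uv k \in codes n by rewrite mem_codes ltn_pmod.
(* The inverse of [elt], by table lookup; the default is reached only outside [G]. *)
pose code_of g := nth (0, false) (codes n) (index g (map elt (codes n))).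
have code_ofK k : k \in codes n -> code_of (elt k) = k.
  by move=> n_k; apply: nth_index_map => //; apply: elt_inj.
pose h g := elt (aut_code n uv (code_of g)).
have hE k : k \in codes n -> h (elt k) = elt (aut_code n uv k).
  by move=> n_k; rewrite /h code_ofK.
have h_inj : {in G &, injective h}.
  move=> _ _ /eltP[k n_k ->] /eltP[l n_l ->]; rewrite !hE //.
  by move/elt_inj=> /(_ (aut_codes k) (aut_codes l))/aut_inj->.
have hG : [set h g | g in G] \subset G.
  by apply/subsetP=> _ /imsetP[g _ ->]; apply: elt_in_G.
exists (perm_in h_inj hG) => [|k n_k]; last by rewrite perm_inE ?hE ?elt_in_G.
rewrite inE perm_in_on; apply/morphicP=> g g' Gg Gg'.
rewrite !perm_inE ?groupM //.
have [[k n_k ->] [l n_l ->]] := (eltP g Gg, eltP g' Gg').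
rewrite elt_mul ?hE ?mulc_codes // elt_mul //; congr elt; apply/eqP.
exact: (allP (autM k n_k)).
Qed.

Lemma listed_setsE (m : nat) :
  listed_sets x y m.*2 = map set_of (listed_codes m).
Proof.
do 11?[case: m => [|m] //]; rewrite /set_of /elt /= ?mul1g;
  by rewrite ?expg1 !set_cons set_nil !setU0 !setUA.
Qed.

End DihedralCoordinates.

(** * The classification *)

Theorem theorem3p11 (gT : finGroupType) (G : {group gT}) (n : nat) (x y : gT)
    (n_ge3 : (3 <= n)%N) (defG : dihedral_generators G n x y) :
  (forall S : {set gT}, locally_maximal_product_free G S -> #|S| = 4 ->
     #|G| \in [:: 8; 10; 12; 14; 16; 18; 20] /\
     exists2 T : {set gT}, T \in listed_sets x y #|G| &
       exists2 f : {perm gT}, f \in Aut G & S = f @: T) /\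
  (forall T : {set gT}, T \in listed_sets x y #|G| ->
     locally_maximal_product_free G T /\ #|T| = 4).
Proof.
rewrite (card_dihedral_generators n_ge3 defG) listed_setsE.
split=> [S maxS S4 | _ /mapP[s /listed_codes_maximal[sn us s4 pfs maxs] ->]].
  have n_le10 := locally_maximal_index_bound n_ge3 defG maxS S4.
  have SG : S \subset G by case: maxS => /product_freeP[].
  have [s sub_s def_S] := set_of_surj n_ge3 defG SG.
  have sn := mem_subseq sub_s; have us := subseq_uniq sub_s (codes_uniq n).
  have s4 : size s = 4 by rewrite -(card_set_of n_ge3 defG sn us) -def_S.
  have s_n0 : s != [::] by rewrite -size_eq0 s4.
  have/allP/(_ s) := maximal_codes_listed (introT andP (conj n_ge3 n_le10)).
  have s_in : s \in subseqs 4 (codes n) by rewrite -s4 mem_subseqs.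
  rewrite !mem_filter s_in andbT andbC.
  rewrite def_S in maxS.
  have -> := (locally_maximal_set_of n_ge3 defG sn s_n0).1 maxS.
  case/(_ isT)/hasP=> c n_c /hasP[uv auts_uv /perm_mem c_s].
  (* Since [c] is listed for n, the list is non-empty; this excludes n = 3 and leaves the seven
     orders. *)
  split; first by move: n_ge3 n_le10 n_c; clear; do 11?[case: n => [|n] //].
  exists (set_of x y c); first exact: map_f.
  have [f Gf fE] := valid_aut_Aut n_ge3 defG auts_uv; exists f => //.
  have [cn _ _ _ _] := listed_codes_maximal n_c.
  rewrite def_S; apply/setP=> g; rewrite inE; apply/mapP/imsetP=> [[k] | [h]].
    rewrite -c_s => /mapP[l c_l ->] ->; exists (elt x y l); rewrite ?fE ?cn //.
    by rewrite inE map_f.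
  rewrite inE => /mapP[k c_k ->] ->; rewrite fE ?cn //.
  by exists (aut_code n uv k); rewrite // -c_s map_f.
split; last by rewrite (card_set_of n_ge3 defG).
by apply/(locally_maximal_set_of n_ge3 defG); rewrite ?pfs // -size_eq0 s4.
Qed.
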